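(* The following statements hold. (i) For every sequence of positive integers $(n_m)_{m\ge1}$, as $m\to\infty$, \[ D_{m,n_m}\longrightarrow1\quad\Longleftrightarrow\quad n_m=o(m). \] (ii) \[ \liminf_{m\to\infty}D_m>1.27 . \]
   Context: For integers $m,n\ge1$ let $\mathcal P_m(\mathbb C^n)$ be the space of $m$-homogeneous complex polynomials $P(z)=\sum_{|\alpha|=m}a_\alpha z^\alpha$ on $\mathbb C^n$. Write $\|P\|_\infty=\sup_{z\in\mathbb D^n}|P(z)|$, $q_m=\frac{2m}{m+1}$, and $\|a(P)\|_p=(\sum_\alpha|a_\alpha|^p)^{1/p}$. Define $D_{m,n}=\sup_{0\ne P\in\mathcal P_m(\mathbb C^n)}\|a(P)\|_{q_m}/\|P\|_\infty$ and $D_m=\sup_{n\ge1}D_{m,n}$ (known to be finite). *)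

(* Defs.v *)
From HB Require Import structures.
From mathcomp Require Import all_boot all_order all_algebra.
From mathcomp Require Import all_classical all_reals all_analysis.
From mathcomp Require Import complex.
(* The notations of mpoly clash with those of mathcomp-analysis. *)
From mathcomp Require Import -(notations) mpoly.

Set Implicit Arguments.
Unset Strict Implicit.
Unset Printing Implicit Defensive.

Import Order.TTheory GRing.Theory Num.Theory.
Import numFieldNormedType.Exports.

Local Open Scope classical_set_scope.
Local Open Scope ring_scope.

(* Real-valued modulus; the norm [`|z|] of [z : R[i]] lives in [R[i]]. *)
Notation modulus := ComplexField.Normc.normc.

Definition polydisc (R : realType) (n : nat) : set ('I_n -> R[i]) :=
  [set z | forall i, modulus (z i) < 1].

(* The supremum is over a nonempty bounded set, so [sup] never takes its
   default value. *)
Definition sup_norm (R : realType) (n : nat) (P : mpoly n R[i]) : R :=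
  sup [set modulus (meval z P) | z in @polydisc R n].

(* For [p != 0], summing over the support is the same as summing over all
   multi-indices. *)
Definition coef_norm (R : realType) (n : nat) (p : R) (P : mpoly n R[i]) : R :=
  (\sum_(alpha <- msupp P) modulus (mcoeff alpha P) `^ p) `^ p^-1.

Definition BH_exponent (R : realType) (m : nat) : R := (2 * m)%:R / m.+1%:R.

(* [ishomog1 m mdeg P] is what mpoly writes [P \is m.-homog]; note that it
   holds for [P = 0]. *)
Definition homog_polys (R : realType) (m n : nat) : set (mpoly n R[i]) :=
  [set P | P \is ishomog1 m mdeg].

(* The suprema are taken in [\bar R], so that they are meaningful without any
   finiteness result. *)
Definition BH_const_dim (R : realType) (m n : nat) : \bar R :=
  ereal_sup [set (coef_norm (BH_exponent R m) P / sup_norm P)%:E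
            | P in [set P | @homog_polys R m n P /\ P != 0]].

Definition BH_const (R : realType) (m : nat) : \bar R :=
  ereal_sup [set BH_const_dim R m n | n in [set n | (0 < n)%N]].

(* Main.v *)
Require Import Defs.
From HB Require Import structures.
From mathcomp Require Import all_boot all_order all_algebra.
From mathcomp Require Import all_classical all_reals all_analysis.
From mathcomp Require Import complex cyclic separable cyclotomic.
From mathcomp Require Import -(notations) mpoly.
From mathcomp Require Import zify ring lra.

(* Upper bound: by Parseval the l^2 norm of the coefficients is at most the sup
   norm, and the l^q_m norm exceeds the l^2 norm by at most N^(1/(2m)), where N is
   the number of monomials; N^(1/m) tends to 1 when n = o(m).

   Lower bound: the Blaschke factor f(z) = (a - z) / (1 - a z) with a^2 = 1/2 has
   Taylor coefficients of modulus a^(k+1), so F(z) = f(z_1) ... f(z_M) is bounded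
   by 1 on the polydisc, has coefficients of modulus a^(|b| + M) and l^2 norm 1,
   and its mass |a_b|^2 is concentrated near degree M (a negative binomial law of
   mean M and variance 2M).  For L = m - M, multiplying F by the Fejer-type
   polynomial T(w) = w (1 + ... + w^(L-1))^2 / L, centred at degree L, and
   keeping the part of degree m gives an m-homogeneous polynomial in M + 1
   variables.  It is still bounded by 1, because the mean of |T| over a circle in
   the unit disc is at most 1, and its l^2 norm is almost 1.  All its coefficients
   have modulus at most 2^(-M/2), so passing from l^2 to l^q_m gains a factor
   2^(M/(2(m+1))).  Taking M proportional to m gives both the necessity of
   n = o(m) and, with M = 3m/4, the bound 1.27.  Replacing f by a partial sum of its
   Taylor series to make F a polynomial costs a factor tending to 1. *)

Set Implicit Arguments.
Unset Strict Implicit.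
Unset Printing Implicit Defensive.

Import Order.TTheory GRing.Theory Num.Theory.
Import numFieldNormedType.Exports.

Local Open Scope classical_set_scope.
Local Open Scope ring_scope.

(** * Discrete Parseval identity over roots of unity *)

Section RootsOfUnity.
Variable C : numClosedFieldType.
Implicit Types (K : nat) (w : C).

(** ['X^K - 1] is separable in characteristic 0, so it has [K] distinct roots, enough to contain a
    primitive one. *)
Lemma closed_prim_root_exists K : (0 < K)%N -> exists w : C, K.-primitive_root w.
Proof.
pose p : {poly C} := 'X^K - 1; have [r Dp] := closed_field_poly_normal p.
move=> K0; rewrite (monicP _) ?monicXnsubC // scale1r in Dp.
have rK1 : all K.-unity_root r by apply/allP=> z; rewrite -root_prod_XsubC -Dp.
have sz_r : (K < (size r).+1)%N.
  by rewrite -(size_prod_XsubC r id) -Dp size_XnsubC.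
have [|w] := hasP (has_prim_root K0 rK1 _ sz_r); last by exists w.
by rewrite -separable_prod_XsubC -Dp separable_Xn_sub_1 // pnatr_eq0 -lt0n.
Qed.

Lemma normr_prim_root K w : K.-primitive_root w -> `|w| = 1.
Proof.
move=> wP; apply/eqP; rewrite -(@pexpr_eq1 _ _ K) ?(prim_order_gt0 wP)//.
by rewrite -normrX (prim_expr_order wP) normr1.
Qed.

Lemma sum_prim_root K w i j : K.-primitive_root w -> (i < K)%N -> (j < K)%N ->
  \sum_(t < K) w ^+ (t * i) * (w ^+ (t * j))^* = K%:R * (i == j)%:R.
Proof.
move=> wP iK jK; pose x := w ^+ i / w ^+ j.
have nw := normr_prim_root wP.
have w0 : w != 0 by rewrite -normr_eq0 nw oner_eq0.
have cw : w^* = w^-1 by rewrite invC_norm nw expr1n invr1 mul1r.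
rewrite (eq_bigr (fun t : 'I_K => x ^+ t)); last first.
  move=> t _; rewrite rmorphXn/= cw exprVn /x exprMn exprVn -!exprM.
  by rewrite ![(_ * t)%N]mulnC.
have xK : x ^+ K = 1.
  rewrite /x exprMn exprVn -!exprM ![(_ * K)%N]mulnC !exprM.
  by rewrite (prim_expr_order wP) !expr1n divr1.
have [eij|nij] := eqVneq i j.
  rewrite /x eij divff ?expf_neq0// mulr1.
  by under eq_bigr do rewrite expr1n; rewrite sumr_const card_ord.
rewrite mulr0; apply/eqP; have := subrX1 x K.
rewrite xK subrr => /esym/eqP; rewrite mulf_eq0 => /orP[|//].
rewrite subr_eq0 => /eqP x1; case/negP: nij.
rewrite -(modn_small iK) -(modn_small jK) -(eq_prim_root_expr wP).
by apply/eqP/divr1_eq.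
Qed.

(** The exponents are distinct modulo [K], so orthogonality leaves only the diagonal terms of the
    expanded square. *)
Lemma parseval_prim_root (I : eqType) (r : seq I) (a : I -> C) (e : I -> nat) K w :
  K.-primitive_root w -> uniq r -> {in r &, injective e} ->
  {in r, forall i, (e i < K)%N} ->
  \sum_(t < K) `|\sum_(i <- r) a i * w ^+ (t * e i)| ^+ 2
    = K%:R * \sum_(i <- r) `|a i| ^+ 2.
Proof.
move=> wP ur einj eK.
under eq_bigr do rewrite normCK rmorph_sum/= mulr_suml.
rewrite exchange_big mulr_sumr /=; apply: eq_big_seq => i ir.
under eq_bigr do rewrite mulr_sumr.
rewrite exchange_big /= (bigD1_seq i)//= [X in _ + X]big1_seq ?addr0; last first.
  move=> j /andP[ji jr].
  transitivity (a i * (a j)^* * \sum_(t < K) w ^+ (t * e i) * (w ^+ (t * e j))^*).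
    by rewrite mulr_sumr; apply: eq_bigr => t _; rewrite rmorphM /=; ring.
  rewrite (sum_prim_root wP) ?eK//.
  have [/(einj _ _ ir jr) eij|_] := eqVneq (e i) (e j); last by rewrite !mulr0.
  by rewrite eij eqxx in ji.
transitivity (a i * (a i)^* * \sum_(t < K) w ^+ (t * e i) * (w ^+ (t * e i))^*).
  by rewrite mulr_sumr; apply: eq_bigr => t _; rewrite rmorphM /=; ring.
by rewrite (sum_prim_root wP) ?eK// eqxx mulr1 normCK mulrC.
Qed.

End RootsOfUnity.

(** * Base-[B] digits and the tent weights *)

(** Reduction modulo [B] recovers the lowest digit. This makes Kronecker's substitution injective on
    exponents. *)
Lemma digits_inj (B n : nat) (f g : nat -> nat) :
  (forall i, (i < n)%N -> (f i < B)%N) -> (forall i, (i < n)%N -> (g i < B)%N) ->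
  (\sum_(i < n) f i * B ^ i = \sum_(i < n) g i * B ^ i)%N ->
  forall i, (i < n)%N -> f i = g i.
Proof.
elim: n f g => [//|n IH] f g fB gB; rewrite !big_ord_recl /= !expn0 !muln1.
have shift (h : nat -> nat) :
    (\sum_(i < n) h (bump 0 i) * B ^ bump 0 i = B * \sum_(i < n) h i.+1 * B ^ i)%N.
  by rewrite big_distrr; apply: eq_bigr => i _; rewrite /bump add1n expnS /=; lia.
rewrite !shift => E.
have f0 := fB 0 isT; have g0 := gB 0 isT.
have B0 : (0 < B)%N by apply: leq_trans f0.
have E0 : f 0 = g 0.
  have := congr1 (modn^~ B) E; rewrite ![(_ + B * _)%N]addnC ![(B * _)%N]mulnC.
  by rewrite !modnMDl !modn_small.
move: E; rewrite E0 => /addnI/eqP; rewrite eqn_pmul2l// => /eqP E [|i] iN //.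
by apply: (IH (f \o S) (g \o S)) => //= j jn; [apply: fB|apply: gB].
Qed.

(* The coefficient of [w^j] in [w (1 + ... + w^(L-1))^2], that is
   [max(0, L - |L - j|)]. *)
Definition tent (L j : nat) : nat := \sum_(s < L) \sum_(s' < L) ((s + s').+1 == j).

Lemma tent0 L : tent L 0 = 0%N.
Proof. by rewrite /tent big1// => s _; rewrite big1. Qed.

Lemma tent_le L j : (tent L j <= L)%N.
Proof.
rewrite -[leqRHS]muln1 -{2}(card_ord L) -sum_nat_const; apply: leq_sum => s _.
have [[s0 /eqP js0]|H] := altP (@existsP _ (fun s' : 'I_L => (s + s').+1 == j)).
  rewrite (bigD1 s0)//= js0 eqxx big1 ?addn0// => i /eqP ni.
  by case: eqP => // E; case: ni; apply: val_inj => /=; lia.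
by rewrite big1// => i _; move/existsPn/(_ i)/negPf: H => ->.
Qed.

Lemma sum_ord_ltn n k : (\sum_(s < n) (s < k) <= k)%N.
Proof.
elim: n k => [|n IH] k; first by rewrite big_ord0.
case: k => [|k]; first by rewrite big1.
by rewrite big_ord_recl; apply: IH.
Qed.

Lemma sum_ord_geq n j : (\sum_(s < n) (j <= s) <= n - j)%N.
Proof.
elim: n => [|n IH]; first by rewrite big_ord0.
rewrite big_ord_recr /=; have [jn|jn] := leqP j n; first by rewrite addn1 subSn.
by rewrite addn0; apply: leq_trans IH _; rewrite leq_sub2r.
Qed.

(** An index [s < L] has a partner [s'] unless [j <= s] or [s < j - L]. With truncated subtraction,
    these exceptions number at most [L - j] and [j - L], together |L - j|. *)
Lemma tent_ge L j : (L <= tent L j + (L - j) + (j - L))%N.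
Proof.
rewrite -[leqLHS]muln1 -{1}(card_ord L) -sum_nat_const.
apply: leq_trans
  (leq_add (leq_add (leqnn _) (sum_ord_geq L j)) (sum_ord_ltn L (j - L))).
rewrite /tent -!big_split /=; apply: leq_sum => s _.
have [js|sj] := leqP j s; first by rewrite addn1 ltn_addr.
have [sL|sL] := ltnP s (j - L); first by rewrite addn1.
rewrite !addn0; have jL : (j - s.+1 < L)%N by have := ltn_ord s; lia.
have E : (s + (j - s.+1)).+1 == j by apply/eqP; lia.
by rewrite (bigD1 (Ordinal jL))//= E.
Qed.

(** * Sup bound for the homogeneous part *)

Section KernelBound.
Variable C : numClosedFieldType.

(* The homogeneous part of degree [m] of [F(z) T(w)], where [F] is the product
   of the [\sum_k c_k z_i^k] and [T(w) = w (1 + ... + w^(L-1))^2], is an average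
   over roots of unity [u] of [F(u z) T(u w)]; and [|T|] has mean at most [L]. *)
Lemma homog_part_le (M N L m : nat) (c : nat -> C) (B : C) (z : 'I_M -> C) (w : C) :
  (forall x, `|x| <= 1 -> `|\sum_(k < N) c k * x ^+ k| <= B) ->
  (forall i, `|z i| <= 1) -> `|w| <= 1 ->
  `|\sum_(b : {ffun 'I_M -> 'I_N}) (\prod_i (c (b i) * z i ^+ b i))
      * ((tent L (m - \sum_i b i))%:R * w ^+ (m - \sum_i b i))| <= L%:R * B ^+ M.
Proof.
move=> cB z1 w1; have B0 : 0 <= B by apply: le_trans (cB 0 _); rewrite ?normr0.
(* [K] exceeds [m] and every exponent [\sum_i b i + (s + s').+1], so averaging over the [K]-th roots
   of unity isolates degree [m] exactly. *)
pose K := (M * N + L + L + m).+1.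
have [u uP] := @closed_prim_root_exists C K isT.
have nu t : `|u ^+ t| = 1 by rewrite normrX (normr_prim_root uP) expr1n.
pose F (x : 'I_M -> C) := \prod_i \sum_(k < N) c k * x i ^+ k.
pose S (x : C) := \sum_(s < L) x ^+ s.
have bM (b : {ffun 'I_M -> 'I_N}) : (\sum_i b i <= M * N)%N.
  rewrite -[leqRHS](_ : (\sum_(i < M) N = _)%N); last by rewrite sum_nat_const card_ord.
  by apply: leq_sum => i _; apply/ltnW/ltn_ord.
set P := \sum_b _.
have EP : K%:R * P = \sum_(t < K) (u ^+ (t * m))^* *
    (F (fun i => u ^+ t * z i) * (u ^+ t * w * S (u ^+ t * w) ^+ 2)).
  have -> : P = \sum_(b : {ffun 'I_M -> 'I_N}) \sum_(s < L) \sum_(s' < L)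
      (\prod_i (c (b i) * z i ^+ b i)) * w ^+ (s + s').+1
        * ((\sum_i b i + (s + s').+1)%N == m)%:R.
    apply: eq_bigr => b _; rewrite /tent natr_sum mulr_suml mulr_sumr.
    apply: eq_bigr => s _; rewrite natr_sum mulr_suml mulr_sumr.
    apply: eq_bigr => s' _; rewrite -mulrA; congr (_ * _).
    (* If |b| >= m, the truncated difference is 0, which no [(s + s').+1] equals, so both sides
       vanish. *)
    have [E|E] := eqVneq (s + s').+1 (m - \sum_i b i)%N.
      rewrite -E mulrC (_ : (_ == m) = true)//; apply/eqP.
      by rewrite E subnKC// ltnW// -subn_gt0 -E.
    rewrite mul0r (_ : (_ == m) = false) ?mulr0//; apply/negP => /eqP E'.
    by case/eqP: E; rewrite -E' addKn.
  transitivity (\sum_(b : {ffun 'I_M -> 'I_N}) \sum_(s < L) \sum_(s' < L)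
      (\prod_i (c (b i) * z i ^+ b i)) * w ^+ (s + s').+1
        * \sum_(t < K) u ^+ (t * (\sum_i b i + (s + s').+1)) * (u ^+ (t * m))^*).
    rewrite mulr_sumr; apply: eq_bigr => b _.
    rewrite mulr_sumr; apply: eq_bigr => s _.
    rewrite mulr_sumr; apply: eq_bigr => s' _.
    rewrite (sum_prim_root uP); first by rewrite mulrCA.
      by rewrite /K; have := bM b; have := ltn_ord s; have := ltn_ord s'; lia.
    by rewrite /K; lia.
  transitivity (\sum_(t < K) \sum_(b : {ffun 'I_M -> 'I_N}) \sum_(s < L) \sum_(s' < L)
      (\prod_i (c (b i) * z i ^+ b i)) * w ^+ (s + s').+1
        * (u ^+ (t * (\sum_i b i + (s + s').+1)) * (u ^+ (t * m))^*)).
    rewrite [RHS]exchange_big; apply: eq_bigr => b _.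
    rewrite [RHS]exchange_big; apply: eq_bigr => s _.
    rewrite [RHS]exchange_big; apply: eq_bigr => s' _.
    by rewrite mulr_sumr.
  apply: eq_bigr => t _ /=.
  have -> : u ^+ t * w * S (u ^+ t * w) ^+ 2
      = \sum_(s < L) \sum_(s' < L) (u ^+ t * w) ^+ (s + s').+1.
    rewrite expr2 /S mulr_suml mulr_sumr; apply: eq_bigr => s _.
    by rewrite !mulr_sumr; apply: eq_bigr => s' _; rewrite exprS exprD.
  rewrite /F bigA_distr_bigA /= mulr_suml mulr_sumr; apply: eq_bigr => b _.
  rewrite !mulr_sumr; apply: eq_bigr => s _.
  rewrite !mulr_sumr; apply: eq_bigr => s' _.
  have -> : \prod_i (c (b i) * (u ^+ t * z i) ^+ b i)
      = u ^+ (t * \sum_i b i) * \prod_i (c (b i) * z i ^+ b i).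
    rewrite big_distrr /= -prodrXr -big_split /=; apply: eq_bigr => i _.
    by rewrite exprMn -exprM mulrCA.
  by rewrite mulnDr exprD exprMn -!exprM; ring.
have : K%:R * `|P| <= K%:R * (L%:R * B ^+ M).
  rewrite -[X in X * `|_|]normr_nat -normrM EP.
  apply: le_trans (ler_norm_sum _ _ _) _.
  apply: (@le_trans _ _ (\sum_(t < K) B ^+ M * `|S (u ^+ t * w)| ^+ 2)).
    apply: ler_sum => t _; rewrite !normrM norm_conjC !nu !mul1r -expr2.
    apply: ler_pM => //.
      rewrite /F normr_prod -[leRHS](_ : \prod_(i < M) B = _); last first.
        by rewrite prodr_const card_ord.
      apply: ler_prod => i _.
      by rewrite normr_ge0 /= cB// normrM nu mul1r.
    by rewrite ler_piMl// exprn_ge0.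
  rewrite -mulr_sumr mulrA [leRHS]mulrC ler_wpM2l ?exprn_ge0//.
  (* Parseval bounds this sum by [K * L], since each [w ^+ s] has modulus at most 1. *)
  have -> : \sum_(t < K) `|S (u ^+ t * w)| ^+ 2
      = \sum_(t < K) `|\sum_(s < L) w ^+ s * u ^+ (t * s)| ^+ 2.
    apply: eq_bigr => t _; congr (`|_| ^+ 2); apply: eq_bigr => s _.
    by rewrite exprMn -exprM mulrC.
  rewrite (parseval_prim_root _ uP) ?index_enum_uniq//; first last.
  - by move=> s _; rewrite /K; have := ltn_ord s; lia.
  - by move=> s s' _ _; apply: val_inj.
  rewrite ler_wpM2l ?ler0n// -[X in _ <= X%:R]card_ord -sumr_const.
  by apply: ler_sum => s _; rewrite normrX exprn_ile1 ?exprn_ge0 ?exprn_ile1.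
by rewrite ler_pM2l ?ltr0n.
Qed.
End KernelBound.

(** * Partial sums of the Blaschke factor *)

(* Taylor coefficients of [(a - x) / (1 - a x)] when [2 a^2 = 1]. *)
Definition mobius_coef (C : pzRingType) (a : C) (k : nat) : C :=
  if k is 0 then a else - a ^+ k.+1.

Lemma mobius_partial_sum (C : comPzRingType) (a x : C) (N : nat) :
  2 * a ^+ 2 = 1 -> (0 < N)%N ->
  (1 - a * x) * (\sum_(k < N) mobius_coef a k * x ^+ k) = a - x + a * (a * x) ^+ N.
Proof.
move=> a2; case: N => // N _; elim: N => [|N IH].
  rewrite big_ord_recl big_ord0 /=.
  have {3}-> : x = 2 * a ^+ 2 * x by rewrite a2 mul1r.
  by ring.
by rewrite big_ord_recr mulrDr IH /= !exprMn !exprS; ring.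
Qed.

(** |1 - a x|^2 - |a - x|^2 = (1 - a^2)(1 - |x|^2) bounds the full Blaschke factor by 1. The
    truncation error is at most a^(N+1) / (1 - a), and a <= 4/5 gives a / (1 - a) <= 4. *)
Lemma mobius_partial_sum_le (C : numClosedFieldType) (a x : C) (N : nat) :
  0 <= a -> 2 * a ^+ 2 = 1 -> `|x| <= 1 ->
  `|\sum_(k < N) mobius_coef a k * x ^+ k| <= 1 + 4 * a ^+ N.
Proof.
move=> a0 a2 x1; case: N => [|N].
  by rewrite big_ord0 normr0 addr_ge0// mulr_ge0// exprn_ge0.
have a2E : a ^+ 2 = 2^-1 by rewrite -[LHS](mulKf (_ : 2 != 0)) ?pnatr_eq0// a2 mulr1.
have a45 : a <= 4 / 5.
  rewrite -(@ler_pXn2r _ 2) ?nnegrE ?divr_ge0 ?ler0n// a2E expr_div_n.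
  by rewrite ler_pdivlMr ?exprn_gt0// ler_pdivrMl// -!natrX -!natrM ler_nat.
have a1 : a < 1 by apply: le_lt_trans a45 _; rewrite ltr_pdivrMr// mul1r ltr_nat.
have Ra : a \is Num.real by apply: ger0_real.
have n1 : 1 - a <= `|1 - a * x|.
  apply: le_trans (lerB_dist _ _); rewrite normr1 lerB// normrM ger0_norm//.
  by rewrite -[leRHS]mulr1 ler_wpM2l.
have p1 : 0 < `|1 - a * x| by apply: lt_le_trans n1; rewrite subr_gt0.
have le_ax : `|a - x| <= `|1 - a * x|.
  rewrite -ler_sqr ?nnegrE// -subr_ge0 !normCK !rmorphB rmorphM rmorph1 /=.
  rewrite (conj_Creal Ra) (_ : _ - _ = (1 - a ^+ 2) * (1 - x * x^*)); last by ring.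
  by rewrite -normCK mulr_ge0 // subr_ge0 exprn_ile1 // ltW.
have E := mobius_partial_sum x a2 (ltn0Sn N).
rewrite -(ler_pM2l p1) -normrM E; apply: le_trans (ler_normD _ _) _.
rewrite mulrDr mulr1 lerD// normrM normrX normrM (ger0_norm a0).
have : a * a ^+ N.+1 <= `|1 - a * x| * (4 * a ^+ N.+1).
  rewrite mulrA ler_wpM2r ?exprn_ge0//.
  apply: (@le_trans _ _ ((1 - a) * 4)); last by rewrite ler_wpM2r.
  have -> : (1 - a) * 4 = 4 - a * 4 by ring.
  rewrite lerBrDr (_ : a + a * 4 = a * 5); last by ring.
  by rewrite -ler_pdivlMr.
apply: le_trans; rewrite exprMn mulrA ler_piMr ?mulr_ge0 ?exprn_ge0//.
by rewrite exprn_ile1.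
Qed.

(** * Concentration of the degree *)

Section Moments.
Variable R : realFieldType.
Implicit Types (M N m : nat) (eta : R).

(** The squared moduli of the Taylor coefficients form a geometric law of mean 1 and variance 2;
    this sum and the next two are its truncated moments. *)
Lemma sum_half_pow N : \sum_(k < N) 2^-1 ^+ k.+1 = 1 - 2^-1 ^+ N :> R.
Proof.
elim: N => [|N IH]; first by rewrite big_ord0 expr0 subrr.
by rewrite big_ord_recr /= IH exprS; field.
Qed.

Lemma mean_half_pow N :
  \sum_(k < N) 2^-1 ^+ k.+1 * (k%:R - 1) = - (N%:R * 2^-1 ^+ N) :> R.
Proof.
elim: N => [|N IH]; first by rewrite big_ord0 mul0r oppr0.
by rewrite big_ord_recr /= IH [2^-1 ^+ N.+1]exprS -[N.+1%:R]natr1; field.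
Qed.

Lemma variance_half_pow N :
  \sum_(k < N) 2^-1 ^+ k.+1 * (k%:R - 1) ^+ 2 = 2 - (N%:R ^+ 2 + 2) * 2^-1 ^+ N :> R.
Proof.
elim: N => [|N IH]; first by rewrite big_ord0 expr0; ring.
by rewrite big_ord_recr /= IH [2^-1 ^+ N.+1]exprS -[N.+1%:R]natr1; field.
Qed.

(** Expand the square over pairs [(i, j)] of independent coordinates: a diagonal pair gives the
    second moment, any other pair the squared mean, and the remaining coordinates a factor at most
    1. *)
Lemma product_second_moment_le (M N : nat) (p x : 'I_N -> R) :
  (forall k, 0 <= p k) -> \sum_k p k <= 1 ->
  \sum_(b : {ffun 'I_M -> 'I_N}) (\prod_i p (b i)) * (\sum_i x (b i)) ^+ 2
    <= M%:R * (\sum_k p k * x k ^+ 2) + (M%:R * \sum_k p k * x k) ^+ 2.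
Proof.
move=> p0 s1; set v := \sum_k p k * x k ^+ 2; set e := \sum_k p k * x k.
have s0 : 0 <= \sum_k p k by apply: sumr_ge0.
have v0 : 0 <= v by apply: sumr_ge0 => k _; rewrite mulr_ge0// sqr_ge0.
(* Writing [x (b i)] as a product over all coordinates lets the sum over [b] factorize. *)
have pick (b : {ffun 'I_M -> 'I_N}) i : \prod_k x (b k) ^+ (k == i) = x (b i).
  rewrite (bigD1 i)//= eqxx expr1 big1 ?mulr1// => k /negPf ->.
  by rewrite expr0.
have -> : \sum_(b : {ffun 'I_M -> 'I_N}) (\prod_i p (b i)) * (\sum_i x (b i)) ^+ 2
    = \sum_(i < M) \sum_(j < M)
       \prod_(k < M) \sum_l p l * (x l ^+ (k == i) * x l ^+ (k == j)).
  under [RHS]eq_bigr do under eq_bigr do rewrite bigA_distr_bigA.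
  under [RHS]eq_bigr do rewrite exchange_big.
  rewrite [RHS]exchange_big /=; apply: eq_bigr => b _.
  rewrite expr2 mulr_suml mulr_sumr; apply: eq_bigr => i _.
  rewrite !mulr_sumr; apply: eq_bigr => j _.
  by rewrite !big_split /= !pick.
have -> : M%:R * v + (M%:R * e) ^+ 2
    = \sum_(i < M) \sum_(j < M) (v * (i == j)%:R + e ^+ 2).
  rewrite (eq_bigr (fun=> v + M%:R * e ^+ 2)); last first.
    move=> i _; rewrite big_split /= sumr_const card_ord mulr_natl; congr (_ + _).
    rewrite -mulr_sumr (bigD1 i)//= eqxx big1 ?addr0 ?mulr1// => j /negPf.
    by rewrite eq_sym => ->.
  by rewrite sumr_const card_ord -[RHS]mulr_natl; ring.
apply: ler_sum => i _; apply: ler_sum => j _.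
have rest_ge0 (P : pred 'I_M) : 0 <= \prod_(k < M | P k) \sum_l p l by apply: prodr_ge0.
have rest_le1 (P : pred 'I_M) : \prod_(k < M | P k) \sum_l p l <= 1.
  by apply: prodr_ile1 => k _; rewrite s0.
have [<-|ij] := eqVneq i j.
  rewrite mulr1; apply: ler_wpDr; first exact: sqr_ge0.
  rewrite (bigD1 i)//= [X in _ * X](eq_bigr (fun=> \sum_l p l)); last first.
    by move=> k /negPf ->; apply: eq_bigr => l _; rewrite !expr0 !mulr1.
  rewrite eqxx; under eq_bigr do rewrite expr1 -expr2.
  by rewrite ler_piMr.
rewrite mulr0 add0r (bigD1 i)//= (bigD1 j) 1?eq_sym//=.
rewrite [X in _ * (_ * X)](eq_bigr (fun=> \sum_l p l)); last first.
  by move=> k /andP[/negPf -> /negPf ->]; apply: eq_bigr => l _; rewrite !expr0 !mulr1.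
rewrite !eqxx [j == i]eq_sym (negPf ij).
under eq_bigr do rewrite expr0 mulr1.
under [X in _ * (X * _)]eq_bigr do rewrite expr0 mul1r.
by rewrite mulrA -expr2 ler_piMr ?sqr_ge0.
Qed.



Lemma tent_shift_ge (M m s : nat) : (M <= m)%N ->
  (m - M <= tent (m - M) (m - s) + ((s - M) + (M - s)))%N.
Proof. by move=> Mm; have := tent_ge (m - M) (m - s); lia. Qed.

(** With [t = T / l] and [u = D / l], [t >= 1 - u] gives t^2 >= 1 - 2u, and 2u <= eta + u^2 / eta.
    The bound is quadratic in [s - M], so that a second moment suffices to integrate it. *)
Lemma tent_sqr_ge (M m s : nat) eta : 0 < eta -> (M < m)%N ->
  1 - eta - (s%:R - M%:R) ^+ 2 / (eta * (m - M)%:R ^+ 2)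
    <= ((tent (m - M) (m - s))%:R / (m - M)%:R) ^+ 2.
Proof.
move=> eta0 Mm; set d := ((s - M) + (M - s))%N; set L := (m - M)%N.
have L0 : 0 < L%:R :> R by rewrite ltr0n subn_gt0.
have -> : (s%:R - M%:R) ^+ 2 = d%:R ^+ 2 :> R.
  rewrite /d; have [sM|/ltnW Ms] := leqP s M.
    by rewrite (eqP sM) add0n natrB// -sqrrN opprB.
  by rewrite (eqP Ms) addn0 natrB.
have H : L%:R <= (tent L (m - s))%:R + d%:R :> R.
  by rewrite -natrD ler_nat; apply/tent_shift_ge/ltnW.
set T : R := (tent L (m - s))%:R in H *; set D : R := d%:R in H *.
set l : R := L%:R in L0 H *.
have T0 : 0 <= T by apply: ler0n.
have D0 : 0 <= D by apply: ler0n.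
have -> : D ^+ 2 / (eta * l ^+ 2) = (D / l) ^+ 2 / eta by field; rewrite !gt_eqF.
have tu : 1 <= T / l + D / l by rewrite -mulrDl ler_pdivlMr// mul1r.
move: (divr_ge0 T0 (ltW L0)) (divr_ge0 D0 (ltW L0)) tu.
move: (T / l) (D / l) => t u t0 u0 tu.
have : 2 * u <= eta + u ^+ 2 / eta.
  rewrite -subr_ge0 (_ : _ - _ = (eta - u) ^+ 2 / eta); last by field; rewrite gt_eqF.
  by rewrite divr_ge0 ?sqr_ge0// ltW.
move: (u ^+ 2 / eta) => V HV.
by nra.
Qed.

(** A Chebyshev argument: [2^-1 ^+ (\sum_i b i + M)] is a product of geometric weights, against
    which the previous bound is summed. *)
Lemma tent_second_moment_ge (M m N : nat) eta : 0 < eta -> eta < 1 -> (M < m)%N ->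
  (1 - eta) * (1 - 2^-1 ^+ N) ^+ M
     - (2 * M%:R + (M%:R * (N%:R * 2^-1 ^+ N)) ^+ 2) / (eta * (m - M)%:R ^+ 2)
  <= \sum_(b : {ffun 'I_M -> 'I_N})
       ((tent (m - M) (m - \sum_i b i))%:R / (m - M)%:R) ^+ 2
         * 2^-1 ^+ (\sum_i b i + M).
Proof.
move=> eta0 eta1 Mm; have L0 : 0 < (m - M)%:R :> R by rewrite ltr0n subn_gt0.
have h0 k : 0 <= 2^-1 ^+ k :> R by rewrite exprn_ge0// invr_ge0.
have prodE (b : {ffun 'I_M -> 'I_N}) :
    2^-1 ^+ (\sum_i b i + M) = \prod_i 2^-1 ^+ (b i).+1 :> R.
  rewrite prodrXr; congr (_ ^+ _); under [RHS]eq_bigr do rewrite -addn1.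
  by rewrite big_split /= sum1_card card_ord.
have sumE (b : {ffun 'I_M -> 'I_N}) :
    (\sum_i b i)%:R - M%:R = \sum_i ((b i)%:R - 1) :> R.
  by rewrite sumrB natr_sum sumr_const card_ord.
apply: (@le_trans _ _ (\sum_(b : {ffun 'I_M -> 'I_N})
    ((1 - eta) - (\sum_i ((b i)%:R - 1)) ^+ 2 / (eta * (m - M)%:R ^+ 2))
      * \prod_i 2^-1 ^+ (b i).+1)); last first.
  apply: ler_sum => b _; rewrite -sumE -prodE ler_wpM2r//.
  exact: tent_sqr_ge.
under eq_bigr do rewrite mulrBl.
rewrite sumrB -mulr_sumr.
have <- : \prod_(i < M) \sum_(k < N) 2^-1 ^+ k.+1
    = \sum_(b : {ffun 'I_M -> 'I_N}) \prod_i 2^-1 ^+ (b i).+1 :> R.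
  by rewrite bigA_distr_bigA.
rewrite prodr_const card_ord sum_half_pow lerB// .
under eq_bigr do rewrite mulrAC.
rewrite -mulr_suml ler_wpM2r ?invr_ge0 ?mulr_ge0 ?exprn_ge0 ?(ltW eta0) ?(ltW L0)//.
under eq_bigr do rewrite mulrC.
apply: le_trans (@product_second_moment_le M N (fun k => 2^-1 ^+ k.+1)
  (fun k => k%:R - 1) _ _) _ => //; first by rewrite sum_half_pow gerBl.
rewrite variance_half_pow mean_half_pow mulrN sqrrN lerD2r [leRHS]mulrC ler_wpM2l//.
by rewrite gerBl mulr_ge0// addr_ge0// sqr_ge0.
Qed.

Lemma bernoulli_sub_ge (x : R) n : 0 <= x -> x <= 1 -> 1 - n%:R * x <= (1 - x) ^+ n.
Proof.
move=> x0 x1; elim: n => [|n IH]; first by rewrite mul0r subr0 expr0.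
rewrite exprSr; apply: le_trans (_ : (1 - n%:R * x) * (1 - x) <= _); last first.
  by rewrite ler_wpM2r// subr_ge0.
by rewrite -natr1; have := ler0n R n; nra.
Qed.

Lemma four_sqr_le_exp m : (0 < m)%N -> (4 * m ^ 2 <= 4 ^ m)%N.
Proof.
case: m => // m _; elim: m => [//|m IH].
have : (4 * (4 * m.+1 ^ 2) <= 4 ^ m.+2)%N by rewrite [leqRHS]expnS leq_mul2l.
by apply: leq_trans; rewrite leq_mul2l -{1}addn1 /=; nia.
Qed.

Lemma half_pow_le m : (0 < m)%N -> 2^-1 ^+ (4 * m) <= (4 * m%:R ^+ 2)^-1 :> R.
Proof.
move=> m0; rewrite -natrX -natrM exprVn.
rewrite lef_pV2 ?posrE ?exprn_gt0 ?ltr0n ?muln_gt0 ?expn_gt0 ?m0//.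
rewrite -natrX ler_nat (leq_trans (four_sqr_le_exp m0))//.
by rewrite -[4%N]/(2 ^ 2)%N -expnM leq_exp2l//; lia.
Qed.

(** The cut-off 4m makes the truncation errors harmless: 4 m^2 <= 2^(4m) gives M 2^(-4m) <= 1/m and
    M (4m) 2^(-4m) <= 1. *)
Lemma tent_mass_ge (M m : nat) eta : 0 < eta -> eta < 1 -> (M < m)%N ->
  (1 - eta) * (1 - m%:R^-1) - (2 * m%:R + 1) / (eta * (m - M)%:R ^+ 2)
  <= \sum_(b : {ffun 'I_M -> 'I_(4 * m)})
       ((tent (m - M) (m - \sum_i b i))%:R / (m - M)%:R) ^+ 2
         * 2^-1 ^+ (\sum_i b i + M).
Proof.
move=> eta0 eta1 Mm; apply: le_trans (tent_second_moment_ge _ eta0 eta1 Mm).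
have m0 : (0 < m)%N by apply: leq_trans Mm.
have mR : 0 < m%:R :> R by rewrite ltr0n.
have h := half_pow_le m0.
have h0 : 0 <= 2^-1 ^+ (4 * m) :> R by rewrite exprn_ge0// invr_ge0.
have MmR : M%:R <= m%:R :> R by rewrite ler_nat ltnW.
have M0 : 0 <= M%:R :> R by apply: ler0n.
have L0 : 0 < (m - M)%:R :> R by rewrite ltr0n subn_gt0.
have hm : 4 * m%:R ^+ 2 * 2^-1 ^+ (4 * m) <= 1 :> R.
  by rewrite -ler_pdivlMl ?mulr1// mulr_gt0// exprn_gt0.
set q := 2^-1 ^+ (4 * m) in h h0 hm *.
have m1 : 1 <= m%:R :> R by rewrite ler1n.
have h1 : q <= 1 by rewrite exprn_ile1// ?invr_ge0// invf_le1// ler1n.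
apply: lerB.
  rewrite ler_wpM2l ?subr_ge0 ?(ltW eta1)//.
  apply: le_trans (bernoulli_sub_ge _ h0 h1); rewrite lerB//.
  by rewrite -div1r ler_pdivlMr//; nra.
rewrite ler_wpM2r ?invr_ge0 ?mulr_ge0 ?exprn_ge0 ?(ltW eta0) ?(ltW L0)//.
rewrite lerD ?ler_wpM2l// exprn_ile1//; first by rewrite !mulr_ge0.
by rewrite natrM; nra.
Qed.

(** Truncating the Blaschke factors costs only a factor tending to 1: x = 4 a^(4m) is at most 1/m^2,
    so 1 - 1/m <= (1 - x)^M by Bernoulli, and (1 + x)(1 - x) <= 1. *)
Lemma mobius_bound_pow_le (a : R) (M m : nat) : 0 <= a -> 2 * a ^+ 2 = 1 ->
  (0 < m)%N -> (M <= m)%N -> (1 + 4 * a ^+ (4 * m)) ^+ M * (1 - m%:R^-1) <= 1.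
Proof.
move=> a0 a2 m0 Mm; set x := 4 * _.
have a2E : a ^+ 2 = 2^-1 by lra.
have mR : 1 <= m%:R :> R by rewrite ler1n.
have x0 : 0 <= x by rewrite mulr_ge0// exprn_ge0.
have xm : m%:R ^+ 2 * x <= 1.
  rewrite /x (_ : a ^+ (4 * m) = (4 ^+ m)^-1); last first.
    rewrite -[4%N]/(2 * 2)%N -mulnA exprM a2E exprVn exprM; congr ((_ ^+ _)^-1).
    by rewrite -natrX.
  rewrite mulrA ler_pdivrMr ?exprn_gt0// mul1r mulrC -!natrX -natrM ler_nat.
  exact: four_sqr_le_exp.
have x1 : x <= 1.
  by apply: le_trans xm; rewrite ler_peMl// exprn_ege1.
apply: (@le_trans _ _ ((1 + x) ^+ M * (1 - x) ^+ M)).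
  rewrite ler_wpM2l ?exprn_ge0 ?addr_ge0//.
  apply: le_trans (bernoulli_sub_ge _ x0 x1); rewrite lerB//.
  have : M%:R <= m%:R :> R by rewrite ler_nat.
  by rewrite -div1r ler_pdivlMr ?(lt_le_trans ltr01 mR)//; have := ler0n R M; nra.
by rewrite -exprMn exprn_ile1//; nra.
Qed.

End Moments.

Lemma ler_sum_subseq (R : numDomainType) (T : eqType) (r s : seq T) (F : T -> R) :
  uniq r -> uniq s -> {subset r <= s} -> (forall x, x \in s -> 0 <= F x) ->
  \sum_(x <- r) F x <= \sum_(x <- s) F x.
Proof.
move=> ur us rs F0; rewrite [leRHS](bigID (mem r)) /= -[X in _ <= X + _]big_filter.
rewrite [X in _ <= X + _](perm_big r) /=.
  by rewrite lerDl big_seq_cond; apply: sumr_ge0 => x /andP[/F0].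
apply: uniq_perm; rewrite ?filter_uniq// => x; rewrite mem_filter /=.
by case: (boolP (x \in r)) => [/rs|].
Qed.

(** * Sup norm and Parseval's inequality on the polydisc *)

Section SupNorm.
Variables (R : realType) (n : nat).
Implicit Types (P : mpoly n R[i]) (z : 'I_n -> R[i]).

Lemma normr_modulus (z : R[i]) : `|z| = ((modulus z)%:C)%C.
Proof. by []. Qed.

Lemma modulus_ge0 (z : R[i]) : 0 <= modulus z.
Proof. by have := normr_ge0 z; rewrite normr_modulus ler0c. Qed.

Lemma modulus_eq0 (z : R[i]) : (modulus z == 0) = (z == 0).
Proof. by rewrite -[RHS]normr_eq0 normr_modulus -[LHS](inj_eq (@complexI R)). Qed.

Lemma polydisc0 : @polydisc R n (fun=> 0).
Proof. by move=> i; rewrite ComplexField.Normc.normc0. Qed.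

Lemma modulus_meval_le P z : polydisc z ->
  modulus (meval z P) <= \sum_(a <- msupp P) modulus (mcoeff a P).
Proof.
move=> zD; rewrite -lecR -normr_modulus mevalE.
apply: le_trans (ler_norm_sum _ _ _) _; rewrite rmorph_sum /=.
apply: ler_sum => a _; rewrite normrM -normr_modulus ler_piMr//.
rewrite normr_prod prodr_ile1// => i _; rewrite normr_ge0 normrX exprn_ile1//.
by rewrite normr_modulus -(rmorph1 (real_complex R)) lecR ltW.
Qed.

Lemma modulus_le_sup_norm P z : polydisc z -> modulus (meval z P) <= sup_norm P.
Proof.
move=> zD; apply: ub_le_sup; last by exists z.
exists (\sum_(a <- msupp P) modulus (mcoeff a P)) => _ [y yD <-].
exact: modulus_meval_le.
Qed.

Lemma sup_norm_ge0 P : 0 <= sup_norm P.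
Proof. exact: le_trans (modulus_ge0 _) (modulus_le_sup_norm P polydisc0). Qed.

Lemma sup_norm_le P (B : R) :
  (forall z, polydisc z -> modulus (meval z P) <= B) -> sup_norm P <= B.
Proof.
move=> PB; apply: ge_sup.
  by exists (modulus (meval (fun=> 0) P)), (fun=> 0); [exact: polydisc0|].
by move=> _ [z zD <-]; apply: PB.
Qed.

(* Kronecker's substitution [z_i = r w^(t B^i)] reduces Parseval's identity to
   one variable. *)
Lemma coef_l2_scaled_le P m (r : R) : homog_polys m P -> 0 < r -> r < 1 ->
  r ^+ (2 * m) * (\sum_(a <- msupp P) modulus (mcoeff a P) ^+ 2) <= sup_norm P ^+ 2.
Proof.
(* Exponents are at most [m], hence are digits in base [m.+1], and [K] exceeds every value of [e]
   below. *)
move=> /dhomogP hP r0 r1; pose B := m.+1; pose K := (\sum_(i < n) m * B ^ i)%N.+1.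
have [w wP] := @closed_prim_root_exists R[i] K isT.
have aB a i : a \in msupp P -> (a i <= m)%N.
  by move=> /hP <-; rewrite /= mdegE (bigD1 i)//= leq_addr.
pose e (a : multinom n) := (\sum_(i < n) a i * B ^ i)%N.
have einj : {in msupp P &, injective e}.
  move=> a b aP bP E; apply/mnmP => i.
  pose ext (c : multinom n) k := if insub k is Some j then c j else 0%N.
  have extE c (j : 'I_n) : ext c j = c j by rewrite /ext valK.
  have ext_lt c : c \in msupp P -> forall k, (k < n)%N -> (ext c k < B)%N.
    by move=> cP k kn; rewrite -[k]/(val (Ordinal kn)) extE ltnS aB.
  have sumE c : (\sum_(j < n) ext c j * B ^ j)%N = e c.
    by apply: eq_bigr => j _; rewrite extE.
  rewrite -!extE; apply: (digits_inj (ext_lt a aP) (ext_lt b bP)) => //.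
  by rewrite !sumE.
have eK : {in msupp P, forall a, (e a < K)%N}.
  by move=> a aP; rewrite ltnS; apply: leq_sum => i _; rewrite leq_mul2r aB ?orbT.
have E := parseval_prim_root (fun a => mcoeff a P * (r%:C)%C ^+ m) wP
  (msupp_uniq P) einj eK.
have nw := normr_prim_root wP.
have K0 : 0 < K%:R :> R[i] by rewrite ltr0n.
have : K%:R * \sum_(a <- msupp P) `|mcoeff a P * (r%:C)%C ^+ m| ^+ 2
     <= K%:R * ((sup_norm P)%:C)%C ^+ 2 :> R[i].
  rewrite -E mulr_natl -[X in _ *+ X]card_ord -sumr_const; apply: ler_sum => t _.
  (* The radius [r < 1] keeps [z] in the open polydisc; by homogeneity it contributes the common
     factor [r ^+ m]. *)
  pose z i := (r%:C)%C * w ^+ (t * B ^ i).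
  have -> : \sum_(a <- msupp P) mcoeff a P * (r%:C)%C ^+ m * w ^+ (t * e a)
      = meval z P.
    rewrite mevalE; apply: eq_big_seq => a aP; rewrite -mulrA; congr (_ * _).
    rewrite -(hP a aP) /= mdegE -prodrXr /e big_distrr /= -prodrXr -big_split /=.
    apply: eq_bigr => i _; rewrite exprMn -exprM; congr (_ * w ^+ _).
    by rewrite mulnCA mulnC.
  rewrite ler_sqr ?nnegrE ?normr_ge0 ?ler0c ?sup_norm_ge0//.
  rewrite normr_modulus lecR modulus_le_sup_norm// => i.
  rewrite -ltcR -normr_modulus normrM normrX nw expr1n mulr1.
  by rewrite ger0_norm ?ler0c ?(ltW r0)// ltcR.
rewrite ler_pM2l// -lecR rmorphM rmorph_sum !rmorphXn /= mulr_sumr.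
congr (_ <= _); apply: eq_bigr => a _.
have rC : `|(r%:C)%C| = (r%:C)%C :> R[i] by rewrite ger0_norm// ler0c ltW.
by rewrite normrM exprMn normrX rC -exprM mulnC mulrC normr_modulus rmorphXn.
Qed.

Lemma coef_l2_le P m : homog_polys m P ->
  \sum_(a <- msupp P) modulus (mcoeff a P) ^+ 2 <= sup_norm P ^+ 2.
Proof.
move=> hP; set S := \sum_(a <- _) _; set T := _ ^+ 2.
have S0 : 0 <= S by apply: sumr_ge0 => a _; rewrite sqr_ge0.
apply/ler_addgt0Pr => e e0.
(* The limit r -> 1 in epsilon form: for r = 1 - e / (D + e), Bernoulli gives r^(2m) S >= S - 2m S e
   / (D + e) >= S - e. The summand [e] keeps [D] positive when [S = 0]. *)
pose D := (2 * m)%:R * S + e; have D0 : 0 < D by rewrite ltr_wpDl// mulr_ge0.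
have De : 0 < D + e by rewrite addr_gt0.
have [D1 D2] : e / (D + e) > 0 /\ e / (D + e) < 1.
  by split; [rewrite divr_gt0|rewrite ltr_pdivrMr// mul1r ltrDr].
set x := e / (D + e) in D1 D2.
have := coef_l2_scaled_le hP (_ : 0 < 1 - x) (_ : 1 - x < 1).
rewrite subr_gt0 D2 gtrBl D1 => /(_ isT isT).
have := bernoulli_sub_ge (2 * m) (ltW D1) (ltW D2).
move=> /(ler_wpM2r S0) H1 H2; have {H1 H2} := le_trans H1 H2.
rewrite mulrBl mul1r lerBlDr -/S -/T => /le_trans; apply; rewrite lerD2l.
rewrite /x mulrAC mulrA ler_pdivrMr//.
by rewrite [leRHS]mulrC ler_wpM2r ?(ltW e0)// /D; lra.
Qed.

Lemma sup_norm_gt0 P m : homog_polys m P -> P != 0 -> 0 < sup_norm P.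
Proof.
move=> hP P0; rewrite lt_neqAle sup_norm_ge0 andbT eq_sym.
apply/negP => /eqP s0; have := coef_l2_le hP; rewrite s0 expr0n /=.
move: P0; rewrite -msupp_eq0; case E : (msupp P) => [//|a r] _.
have : modulus (mcoeff a P) != 0.
  by rewrite modulus_eq0 -mcoeff_msupp E mem_head.
rewrite big_cons => a0; apply/negP; rewrite -ltNge ltr_pwDl//.
  by rewrite exprn_gt0// lt_neqAle eq_sym a0 modulus_ge0.
by apply: sumr_ge0 => b _; rewrite sqr_ge0.
Qed.

End SupNorm.

(** * Counting monomials and the upper bound *)

(** Enlarging the sum to all multi-indices with entries at most [m] gives a product of [n] partial
    geometric series. This bounds the number of monomials by y^(-m) (1 - y)^(-n). *)
Lemma sum_homog_weight_le (R : realFieldType) (n m : nat) (y : R)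
    (s : seq (multinom n)) :
  uniq s -> {in s, forall a, mdeg a = m} -> 0 < y -> y < 1 ->
  \sum_(a <- s) y ^+ m <= ((1 - y) ^+ n)^-1.
Proof.
move=> us sm y0 y1.
pose f (a : multinom n) : {ffun 'I_n -> 'I_m.+1} := [ffun i => inord (a i)].
have fE a i : a \in s -> f a i = a i :> nat.
  by move=> /sm am; rewrite ffunE inordK// ltnS -am mdegE (bigD1 i)//= leq_addr.
have finj : {in s &, injective f}.
  by move=> a b sa sb E; apply/mnmP => i; rewrite -fE// E fE.
have -> : \sum_(a <- s) y ^+ m = \sum_(b <- map f s) \prod_i y ^+ b i.
  rewrite big_map; apply: eq_big_seq => a sa; rewrite prodrXr; congr (_ ^+ _).
  by rewrite -[LHS](sm a sa) mdegE; apply: eq_bigr => i _; rewrite fE.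
apply: (@le_trans _ _ (\sum_(b : {ffun 'I_n -> 'I_m.+1}) \prod_i y ^+ b i)).
  apply: ler_sum_subseq; rewrite ?map_inj_in_uniq ?index_enum_uniq//.
    by move=> b _; rewrite mem_index_enum.
  by move=> b _; apply: prodr_ge0 => i _; rewrite exprn_ge0// ltW.
rewrite -(bigA_distr_bigA (fun (i : 'I_n) (k : 'I_m.+1) => y ^+ k)).
rewrite prodr_const card_ord.
rewrite -exprVn lerXn2r ?nnegrE ?invr_ge0 ?subr_ge0 ?(ltW y1)//.
  by apply: sumr_ge0 => k _; rewrite exprn_ge0// ltW.
rewrite -div1r ler_pdivlMr ?subr_gt0// mulrC.
rewrite -[1 - y]opprB mulNr -subrX1 opprB.
by rewrite gerBl exprn_ge0// ltW.
Qed.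

Section Upper.
Variable R : realType.

(** The condition on [y] makes the number of monomials at most y^(-2m), whose power 1/(2m) is 1/y. A
    termwise Young inequality on the normalized coefficients takes the place of Hölder's. *)
Lemma coef_norm_le (n m : nat) (y : R) (P : mpoly n R[i]) :
  (0 < m)%N -> 0 < y -> y < 1 -> y ^+ m <= (1 - y) ^+ n ->
  homog_polys m P -> P != 0 -> coef_norm (BH_exponent R m) P <= sup_norm P / y.
Proof.
move=> m0 y0 y1 ymn hP P0; have s0 := sup_norm_gt0 hP P0.
set s := sup_norm P in s0 *.
set q := BH_exponent R m.
have mR : 0 < m%:R :> R by rewrite ltr0n.
have m1R : 0 < m.+1%:R :> R by rewrite ltr0n.
have q0 : 0 < q by rewrite divr_gt0 ?ltr0n ?muln_gt0.
have y1n : 0 < (1 - y) ^+ n by rewrite exprn_gt0// subr_gt0.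
(* Weighted AM-GM: [(u y)^q = (u^2)^(m/(m+1)) (y^(2m))^(1/(m+1))]. *)
have young u : 0 <= u ->
    (u * y) `^ q <= m%:R / m.+1%:R * u ^+ 2 + m.+1%:R^-1 * y ^+ (2 * m).
  move=> u0; rewrite powRM ?(ltW y0)//.
  apply: le_trans (conjugate_powR (p := m.+1%:R / m%:R) (q := m.+1%:R) _ _ _ _ _) _;
    rewrite ?powR_ge0 ?divr_gt0//.
    by rewrite -natr1; field; rewrite natr1 !gt_eqF.
  rewrite -!powRrM /q /BH_exponent natrM.
  rewrite (_ : 2 * _ / _ * _ = 2); last by field; rewrite !gt_eqF.
  rewrite (_ : 2 * _ / _ * _ = 2 * m%:R); last by field; rewrite gt_eqF.
  rewrite -natrM !powR_mulrn ?(ltW y0)//.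
  by rewrite invf_div mulrC lerD2l mulrC.
have main : \sum_(a <- msupp P) modulus (mcoeff a P) `^ q <= (s / y) `^ q.
  have -> : \sum_(a <- msupp P) modulus (mcoeff a P) `^ q
      = (s / y) `^ q * \sum_(a <- msupp P) (modulus (mcoeff a P) / s * y) `^ q.
    rewrite mulr_sumr; apply: eq_bigr => a _.
    rewrite -powRM ?mulr_ge0 ?invr_ge0 ?modulus_ge0 ?(ltW y0) ?(ltW s0)//.
    by congr (_ `^ _); field; rewrite !gt_eqF.
  rewrite ler_piMr ?powR_ge0//.
  apply: (@le_trans _ _ (\sum_(a <- msupp P)
    (m%:R / m.+1%:R * (modulus (mcoeff a P) / s) ^+ 2
     + m.+1%:R^-1 * y ^+ (2 * m)))).
    by apply: ler_sum => a _; rewrite young// divr_ge0 ?modulus_ge0 ?ltW.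
  rewrite big_split /= -!mulr_sumr.
  have l2 : \sum_(a <- msupp P) (modulus (mcoeff a P) / s) ^+ 2 <= 1.
    under eq_bigr do rewrite expr_div_n.
    by rewrite -mulr_suml ler_pdivrMr ?exprn_gt0// mul1r; apply: coef_l2_le hP.
  have cnt : \sum_(a <- msupp P) y ^+ (2 * m) <= 1.
    under eq_bigr do rewrite mul2n -addnn exprD.
    rewrite -mulr_suml.
    have degP : {in msupp P, forall a, mdeg a = m} by apply/dhomogP.
    have := sum_homog_weight_le (msupp_uniq P) degP y0 y1.
    move=> /(ler_wpM2r (exprn_ge0 m (ltW y0)))/le_trans; apply.
    by rewrite mulrC ler_pdivrMr// mul1r.
  rewrite -[leRHS](_ : m%:R / m.+1%:R * 1 + m.+1%:R^-1 * 1 = 1); last first.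
    by rewrite -natr1; field; rewrite natr1 gt_eqF.
  by apply: lerD; rewrite ler_wpM2l ?divr_ge0 ?invr_ge0 ?ler0n.
have sy0 : 0 <= s / y by rewrite divr_ge0 ?ltW.
rewrite /coef_norm; apply: (@le_trans _ _ (((s / y) `^ q) `^ q^-1)).
  apply: ge0_ler_powR; rewrite ?nnegrE ?invr_ge0 ?(ltW q0) ?powR_ge0//.
  by apply: sumr_ge0 => a _; apply: powR_ge0.
by rewrite -powRrM divff ?gt_eqF// powRr1.
Qed.

Lemma BH_const_dim_le (n m : nat) (y : R) :
  (0 < m)%N -> 0 < y -> y < 1 -> y ^+ m <= (1 - y) ^+ n ->
  (BH_const_dim R m n <= (y^-1)%:E)%E.
Proof.
move=> m0 y0 y1 ymn; apply: ge_ereal_sup => _ [P [hP P0] <-].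
rewrite lee_fin ler_pdivrMr ?(sup_norm_gt0 hP)// mulrC.
exact: coef_norm_le.
Qed.

Lemma BH_const_dim_ge (n m : nat) (P : mpoly n R[i]) (B : R) :
  homog_polys m P -> P != 0 -> sup_norm P <= B ->
  ((coef_norm (BH_exponent R m) P / B)%:E <= BH_const_dim R m n)%E.
Proof.
move=> hP P0 PB; apply: le_trans (ereal_sup_ubound _); last by exists P.
have s0 := sup_norm_gt0 hP P0.
rewrite lee_fin ler_wpM2l ?powR_ge0// lef_pV2 ?posrE//.
exact: lt_le_trans PB.
Qed.

Lemma BH_const_dim_ge1 (n m : nat) : (0 < n)%N -> (1 <= BH_const_dim R m n)%E.
Proof.
move=> n0; pose a : multinom n := mnm_muln (mnm1 (Ordinal n0)) m.
pose P : mpoly n R[i] := mpolyX _ a.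
have Pa : mcoeff a P = 1 by rewrite mcoeffX eqxx.
have P1 : modulus (mcoeff a P) = 1 by rewrite Pa ComplexField.Normc.normc1.
have P0 : P != 0 by apply: contra_eq_neq Pa => ->; rewrite mcoeff0 eq_sym oner_eq0.
have hP : homog_polys m P.
  by apply/dhomogP => b; rewrite msuppX inE => /eqP ->; rewrite /= mdegMn mdeg1 mul1n.
have sP : sup_norm P <= 1.
  apply: sup_norm_le => z zD; apply: le_trans (modulus_meval_le _ zD) _.
  by rewrite msuppX big_seq1 P1.
have := BH_const_dim_ge hP P0 sP.
by rewrite /coef_norm msuppX big_seq1 P1 !powR1 divr1.
Qed.
End Upper.

(** * Homogenization, with [k] spare variables *)

Section Homogenize.
Variables (M k N m : nat).

(* The exponent of [w^(m - |b|) z^b], with [w] the first of the variables and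
   [z] the next [M] of them. *)
Definition homogenize (b : {ffun 'I_M -> 'I_N}) : multinom (M + k).+1 :=
  Multinom [tuple if unlift ord0 i is Some j
                  then (if fintype.split j is inl l then b l : nat else 0%N)
                  else (m - \sum_l b l)%N | i < (M + k).+1].

Lemma homogenize0 b : homogenize b ord0 = (m - \sum_l b l)%N.
Proof. by rewrite mnmE unlift_none. Qed.

Lemma homogenizel b (l : 'I_M) : homogenize b (lift ord0 (lshift k l)) = b l.
Proof. by rewrite mnmE liftK (unsplitK (inl l)). Qed.

Lemma homogenizer b (l : 'I_k) : homogenize b (lift ord0 (rshift M l)) = 0%N.
Proof. by rewrite mnmE liftK (unsplitK (inr l)). Qed.

Lemma homogenize_inj : injective homogenize.
Proof.
move=> b b' E; apply/ffunP => l; apply: val_inj.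
by rewrite /= -!homogenizel E.
Qed.

Lemma mdeg_homogenize (b : {ffun 'I_M -> 'I_N}) :
  (\sum_l b l <= m)%N -> mdeg (homogenize b) = m.
Proof.
move=> bm; rewrite mdegE big_ord_recl homogenize0 big_split_ord /=.
rewrite (eq_bigr _ (fun l _ => homogenizel b l)) [X in (_ + (_ + X))%N]big1.
  by rewrite addn0 subnK.
by move=> l _; rewrite homogenizer.
Qed.

Lemma prod_homogenize (A : comPzRingType) (z : 'I_(M + k).+1 -> A)
    (b : {ffun 'I_M -> 'I_N}) :
  \prod_i z i ^+ homogenize b i
    = z ord0 ^+ (m - \sum_l b l) * \prod_l z (lift ord0 (lshift k l)) ^+ b l.
Proof.
rewrite big_ord_recl homogenize0 big_split_ord /=.
rewrite [X in _ * (_ * X)]big1 ?mulr1; last by move=> l _; rewrite homogenizer.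
by congr (_ * _); apply: eq_bigr => l _; rewrite homogenizel.
Qed.

End Homogenize.

Section SparseSum.
Variables (n : nat) (A : nzRingType) (I : finType).
Variables (e : I -> multinom n) (c : I -> A).
Hypothesis e_inj : injective e.

Let P : mpoly n A := \sum_i c i *: mpolyX A (e i).

Lemma mcoeff_sparse i : mcoeff (e i) P = c i.
Proof.
rewrite raddf_sum (bigD1 i)//= mcoeffZ mcoeffX eqxx mulr1 big1 ?addr0// => j ji.
by rewrite mcoeffZ mcoeffX (inj_eq e_inj) (negPf ji) mulr0.
Qed.

Lemma sum_sparse_le (R : numDomainType) (f : A -> R) :
  f 0 = 0 -> (forall x, 0 <= f x) ->
  \sum_i f (c i) <= \sum_(a <- msupp P) f (mcoeff a P).
Proof.
move=> f0 fge0.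
have -> : \sum_i f (c i)
    = \sum_(a <- [seq e i | i <- index_enum I & c i != 0]) f (mcoeff a P).
  rewrite big_map big_filter /= [LHS](bigID (fun i => c i != 0)) /=.
  rewrite [X in _ + X]big1 ?addr0; last by move=> i; rewrite negbK => /eqP ->.
  by apply: eq_bigr => i _; rewrite mcoeff_sparse.
apply: ler_sum_subseq; rewrite ?msupp_uniq//.
  by rewrite map_inj_uniq// filter_uniq// index_enum_uniq.
move=> _ /mapP[i + ->]; rewrite mem_filter => /andP[ci _].
by rewrite mcoeff_msupp mcoeff_sparse.
Qed.

End SparseSum.

(** * The extremal polynomial and its norms *)

Section Lower.
Variable R : realType.
Variables (M k m : nat).
Hypothesis Mm : (M < m)%N.
Let L := (m - M)%N.
Let N := (4 * m)%N.
Let a : R := Num.sqrt 2^-1.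
Let A : R[i] := (a%:C)%C.

(* [extremal] is [L] times the polynomial of the header, with [f] truncated to
   degree less than [N]. *)
Definition extremal_coef (b : {ffun 'I_M -> 'I_N}) : R[i] :=
  (\prod_i mobius_coef A (b i)) * (tent L (m - \sum_i b i))%:R.

Definition extremal : mpoly (M + k).+1 R[i] :=
  \sum_b extremal_coef b *: mpolyX R[i] (homogenize k m b).

Let a0 : 0 < a. Proof. by rewrite sqrtr_gt0 invr_gt0. Qed.
Let a2 : 2 * a ^+ 2 = 1. Proof. by rewrite sqr_sqrtr ?invr_ge0// mulfV. Qed.
Let A0 : 0 <= A. Proof. by rewrite ler0c ltW. Qed.
Let A2 : 2 * A ^+ 2 = 1.
Proof. by rewrite -rmorphXn -(rmorph_nat (real_complex R)) -rmorphM a2 rmorph1. Qed.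
Let L0 : 0 < L%:R :> R. Proof. by rewrite ltr0n subn_gt0. Qed.

Lemma extremal_homog : homog_polys m extremal.
Proof.
apply: rpred_sum => b _; have [bm|bm] := leqP (\sum_i b i) m.
  by apply/dhomogZ; rewrite dhomogX; apply/eqP/mdeg_homogenize.
(* For |b| > m the monomial has the wrong degree, but the truncated difference is 0 and [tent]
   vanishes there. *)
by rewrite /extremal_coef (eqP (ltnW bm)) tent0 mulr0 scale0r rpred0.
Qed.

Lemma modulus_extremal_coef b : modulus (extremal_coef b)
  = (tent L (m - \sum_i b i))%:R * a ^+ (\sum_i b i + M).
Proof.
apply: complexI; rewrite -normr_modulus normrM normr_nat mulrC rmorphM rmorph_nat.
congr (_ * _); rewrite normr_prod rmorphXn /= -/A.
rewrite -[X in (_ + X)%N](card_ord M) -sum1_card -big_split /= -prodrXr.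
apply: eq_bigr => i _; rewrite addn1.
by case: (b i : nat) => [|j] /=; rewrite ?normrN ?normrX (ger0_norm A0).
Qed.

Lemma extremal_sup_norm_le : sup_norm extremal <= L%:R * (1 + 4 * a ^+ N) ^+ M.
Proof.
apply: sup_norm_le => z zD; rewrite -lecR -normr_modulus raddf_sum /=.
have z1 i : `|z i| <= 1.
  by rewrite normr_modulus -(rmorph1 (real_complex R)) lecR ltW.
have cB x : `|x| <= 1 -> `|\sum_(j < N) mobius_coef A j * x ^+ j| <= 1 + 4 * A ^+ N.
  exact: mobius_partial_sum_le.
have := @homog_part_le _ M N L m _ _ (fun l => z (lift ord0 (lshift k l))) (z ord0)
  cB (fun l => z1 _) (z1 _).
rewrite rmorphM rmorphXn rmorphD rmorphM rmorphXn /= rmorph1 !rmorph_nat.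
congr (_ <= _); congr (`|_|); apply: eq_bigr => b _.
by rewrite mevalZ mevalX prod_homogenize big_split /extremal_coef /=; ring.
Qed.

End Lower.

Section LowerNorm.
Variable R : realType.
Variables (M k m : nat).
Hypothesis Mm : (M < m)%N.
Let a : R := Num.sqrt 2^-1.
Let a0 : 0 < a. Proof. by rewrite sqrtr_gt0 invr_gt0. Qed.
Let a2 : 2 * a ^+ 2 = 1. Proof. by rewrite sqr_sqrtr ?invr_ge0// mulfV. Qed.

(* Lowering the exponent from 2 to [2m / (m + 1)] multiplies the power of
   [a ^ X = 2 ^ (- X / 2)] by [2 ^ (X / (m + 1))]. *)
Lemma powR_BH_exponent_ge (t : R) (X : nat) : (M <= X)%N -> 0 <= t -> t <= 1 ->
  2 `^ (M%:R / m.+1%:R) * (t ^+ 2 * 2^-1 ^+ X) <= (t * a ^+ X) `^ BH_exponent R m.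
Proof.
move=> MX t0 t1; have m0 : (0 < m)%N by apply: leq_ltn_trans Mm.
have mR : 0 < m%:R :> R by rewrite ltr0n.
have m1R : 0 < m.+1%:R :> R by rewrite ltr0n.
rewrite powRM ?exprn_ge0 ?(ltW a0)// mulrCA; apply: ler_pM.
- by rewrite exprn_ge0.
- by rewrite mulr_ge0 ?powR_ge0// exprn_ge0// invr_ge0.
(* The exponent is at most 2 and [t <= 1]; [t = 0] is apart because [ger_powR] needs a positive
   base. *)
- move: t0; rewrite le_eqVlt => /predU1P[<-|t0].
    by rewrite expr0n powR_ge0.
  rewrite -powR_mulrn ?(ltW t0)//; apply: ger_powR; first by rewrite t0.
  rewrite /BH_exponent ler_pdivrMr// natrM ler_pM2l// ler_nat.
  exact: leqnSn.
(* Uses 2m / (m + 1) = 2 - 2 / (m + 1) and a^2 = 1/2. *)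
have -> : (a ^+ X) `^ BH_exponent R m = 2 `^ (X%:R / m.+1%:R) * 2^-1 ^+ X.
  rewrite -powR_mulrn ?(ltW a0)// -powRrM.
  have -> : X%:R * BH_exponent R m = 2 * (X%:R - X%:R / m.+1%:R).
    by rewrite /BH_exponent natrM -[m.+1%:R]natr1; field; rewrite natr1 gt_eqF.
  rewrite powRrM powR_mulrn ?(ltW a0)// (sqr_sqrtr (_ : 0 <= 2^-1 :> R)) ?invr_ge0//.
  rewrite -powR_inv1// -powRrM mulN1r opprB powRD ?pnatr_eq0 ?implybT//.
  by rewrite -powR_mulrn ?powR_ge0// -powRrM mulN1r.
rewrite ler_wpM2r ?exprn_ge0 ?invr_ge0//; apply: ler_powR; first by rewrite ler1n.
by rewrite ler_pM2r ?invr_gt0// ler_nat.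
Qed.

(** The sum of q-th powers is at least L^q 2^(M/(m+1)) sigma. Its root has exponent 1/q = (m+1)/(2m)
    <= 1, so sigma <= 1 can only grow, and the power of 2 becomes M/(2m) >= M/(2(m+1)). *)
Lemma coef_norm_extremal_ge (sigma : R) : 0 < sigma -> sigma <= 1 ->
  sigma <= \sum_(b : {ffun 'I_M -> 'I_(4 * m)})
    ((tent (m - M) (m - \sum_i b i))%:R / (m - M)%:R) ^+ 2
      * 2^-1 ^+ (\sum_i b i + M) ->
  (m - M)%:R * (sigma * 2 `^ (M%:R / (2 * m.+1%:R)))
    <= coef_norm (BH_exponent R m) (@extremal R M k m).
Proof.
move=> s0 s1 sS; have m0 : (0 < m)%N by apply: leq_ltn_trans Mm.
have mR : 0 < m%:R :> R by rewrite ltr0n.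
have m1R : 0 < m.+1%:R :> R by rewrite ltr0n.
set q := BH_exponent R m; have q0 : 0 < q by rewrite divr_gt0 ?ltr0n ?muln_gt0.
set L := (m - M)%N in sS *; have L0 : 0 < L%:R :> R by rewrite ltr0n subn_gt0.
pose T := 2 `^ (M%:R / m.+1%:R) * sigma.
have T0 : 0 <= T by rewrite mulr_ge0 ?powR_ge0 ?ltW.
have LT : L%:R `^ q * T <= \sum_(b <- msupp (@extremal R M k m))
    modulus (mcoeff b (@extremal R M k m)) `^ q.
  apply: le_trans (sum_sparse_le (@extremal_coef R M m)
    (@homogenize_inj M k (4 * m) m)
    (f := fun x => modulus x `^ q) _ _); last 2 first.
  - by rewrite ComplexField.Normc.normc0 powR0 ?gt_eqF.
  - by move=> x; apply: powR_ge0.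
  apply: (@le_trans _ _ (L%:R `^ q * (2 `^ (M%:R / m.+1%:R) *
     \sum_(b : {ffun 'I_M -> 'I_(4 * m)})
    ((tent L (m - \sum_i b i))%:R / L%:R) ^+ 2 * 2^-1 ^+ (\sum_i b i + M)))).
    by rewrite ler_wpM2l ?powR_ge0// ler_wpM2l ?powR_ge0.
  rewrite !mulr_sumr; apply: ler_sum => b _; rewrite modulus_extremal_coef -/L.
  have tL : 0 <= (tent L (m - \sum_i b i))%:R / L%:R :> R by rewrite divr_ge0 ?ler0n.
  have t1 : (tent L (m - \sum_i b i))%:R / L%:R <= 1 :> R.
    by rewrite ler_pdivrMr// mul1r ler_nat tent_le.
  have -> : (tent L (m - \sum_i b i))%:R
      = L%:R * ((tent L (m - \sum_i b i))%:R / L%:R) :> R.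
    by rewrite mulrC divfK ?gt_eqF.
  move: (_ / L%:R) tL t1 => t t0 t1.
  rewrite [L%:R * t]mulrC mulfK ?gt_eqF// [t * _]mulrC.
  rewrite -(mulrA L%:R) (powRM _ (ler0n _ _)) ?mulr_ge0 ?exprn_ge0 ?(ltW a0)//.
  by rewrite ler_wpM2l ?powR_ge0// powR_BH_exponent_ge ?leq_addl.
rewrite /coef_norm; apply: (@le_trans _ _ ((L%:R `^ q * T) `^ q^-1)); last first.
  apply: ge0_ler_powR;
    rewrite ?nnegrE ?invr_ge0 ?(ltW q0) ?mulr_ge0 ?powR_ge0 ?(ltW s0)//.
  by apply: sumr_ge0 => b _; apply: powR_ge0.
rewrite powRM ?powR_ge0// -powRrM divff ?gt_eqF// powRr1 ?ler0n// ler_pM2l//.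
have qm : q^-1 = m.+1%:R / (2 * m%:R) by rewrite /q /BH_exponent invf_div natrM.
rewrite /T powRM ?powR_ge0 ?(ltW s0)// [leRHS]mulrC -powRrM; apply: ler_pM.
- exact: ltW.
- exact: powR_ge0.
- rewrite -[leLHS]powRr1 ?(ltW s0)//; apply: ger_powR; first by rewrite s0.
  rewrite qm ler_pdivrMr ?mulr_gt0// mul1r -natrM ler_nat.
  lia.
apply: ler_powR; first by rewrite ler1n.
rewrite qm (_ : _ / _ * _ = M%:R / (2 * m%:R)); last by field; rewrite !gt_eqF.
by rewrite ler_wpM2l ?ler0n// lef_pV2 ?posrE ?mulr_gt0// ler_pM2l// ler_nat.
Qed.

End LowerNorm.

(** * Asymptotic lower bound and the constant 1.27 *)

Section LowerConst.
Variable R : realType.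

Lemma BH_const_dim_ge_tent (m M n : nat) (sigma : R) :
  (M < m)%N -> (M < n)%N -> 0 < sigma -> sigma <= 1 ->
  sigma <= \sum_(b : {ffun 'I_M -> 'I_(4 * m)})
    ((tent (m - M) (m - \sum_i b i))%:R / (m - M)%:R) ^+ 2
      * 2^-1 ^+ (\sum_i b i + M) ->
  ((sigma * (1 - m%:R^-1) * 2 `^ (M%:R / (2 * m.+1%:R)))%:E <= BH_const_dim R m n)%E.
Proof.
move=> Mm Mn s0 s1 sS; have m0 : (0 < m)%N by apply: leq_ltn_trans Mm.
have [k ->] : exists k, n = (M + k).+1 by exists (n - M.+1)%N; rewrite -addSn subnKC.
have L0 : 0 < (m - M)%:R :> R by rewrite ltr0n subn_gt0.
have := @coef_norm_extremal_ge R M k m Mm sigma s0 s1 sS.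
have := @extremal_sup_norm_le R M k m.
have := @extremal_homog R M k m.
set P := extremal _ _ _ _; set W := 2 `^ _; set a := Num.sqrt _ => hP sP cP.
have W0 : 0 < W by rewrite powR_gt0.
have LsW : 0 < (m - M)%:R * (sigma * W) by rewrite !mulr_gt0.
(* The zero polynomial has [coef_norm] equal to a power of 0, which is 0 because the exponent [q^-1]
   is nonzero; [cP] excludes this. *)
have P0 : P != 0.
  apply/eqP => P0; move: cP; rewrite P0 /coef_norm msupp0 big_nil powR0 ?leNgt ?LsW//.
  by rewrite invr_eq0 mulf_neq0 ?invr_eq0 ?pnatr_eq0// muln_eq0 -lt0n.
apply: le_trans (BH_const_dim_ge hP P0 sP); rewrite lee_fin.
have a0 : 0 <= a by apply: sqrtr_ge0.
have a2 : 2 * a ^+ 2 = 1 by rewrite sqr_sqrtr ?invr_ge0// mulfV.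
have := mobius_bound_pow_le a0 a2 m0 (ltnW Mm).
set B := (1 + _) ^+ M; have B0 : 0 < B.
  by rewrite exprn_gt0// ltr_pwDl// mulr_ge0// exprn_ge0.
move=> Bm; rewrite ler_pdivlMr ?mulr_gt0//; apply: le_trans cP.
rewrite [leLHS](_ : _ = (m - M)%:R * (sigma * W) * (B * (1 - m%:R^-1))).
  by rewrite ler_piMr// ltW.
by move: (m%:R^-1) (m - M)%:R => x l; ring.
Qed.

(** Uniformity in [M] and [n] lets both depend on [m]. The condition on [M] gives m - M >= m/4, so
    the Chebyshev error is O(1/m). *)
Lemma BH_const_dim_eventually_ge (kappa : R) : 0 < kappa -> kappa < 1 ->
  \forall m \near \oo, forall M n, (4 * M <= 3 * m)%N -> (M < n)%N ->
    ((kappa * 2 `^ (M%:R / (2 * m.+1%:R)))%:E <= BH_const_dim R m n)%E.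
Proof.
move=> k0 k1; pose eta := (1 - kappa) / 2.
have [e0 e1 kE] : [/\ 0 < eta, eta < 2^-1 & kappa = 1 - 2 * eta].
  by rewrite /eta; split; lra.
clearbody eta.
near=> m; move=> M n Mm Mn.
have m0 : (0 < m)%N by near: m; exact: nbhs_infty_gt.
have mR : 0 < m%:R :> R by rewrite ltr0n.
(* The total loss is at most eta + 2u + 48w <= eta + 50w, and 50w <= eta keeps it within 2 eta = 1 -
   kappa. *)
have m50 : 50 / eta ^+ 2 <= m%:R :> R by near: m; exact: nbhs_infty_ger.
pose u : R := m%:R^-1; pose w := u / eta.
have u0 : 0 < u by rewrite invr_gt0.
have uw : u = eta * w by rewrite /w mulrC divfK ?gt_eqF.
have w0 : 0 < w by rewrite divr_gt0.
have w50 : 50 * w <= eta.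
  move: m50; rewrite ler_pdivrMr ?exprn_gt0// => H.
  by rewrite /w /u mulrA ler_pdivrMr// -expr2 ler_pdivrMr// mulrC.
have Mltm : (M < m)%N by lia.
have mL4 : (m <= 4 * (m - M))%N by lia.
(* 48 = 3 * 16, from 2m + 1 <= 3m and m^2 <= 16 (m - M)^2. *)
pose sigma := (1 - eta) * (1 - u) - 48 * w.
have eu : 0 <= eta * u by rewrite mulr_ge0 ?ltW.
have u_le_w : u <= w by rewrite uw; nra.
have s0 : 0 < sigma by rewrite /sigma; lra.
have s1 : sigma <= 1.
  have : eta * u <= u by rewrite ler_piMl ?ltW//; lra.
  by rewrite /sigma; lra.
have eta1 : eta < 1 by lra.
have sS := tent_mass_ge e0 eta1 Mltm.
apply: le_trans (BH_const_dim_ge_tent Mltm Mn s0 s1 _).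
  rewrite lee_fin ler_wpM2r ?powR_ge0// -/u.
  have : sigma * u <= u by rewrite ler_piMl // ltW.
  by rewrite kE mulrBr mulr1 {2}/sigma; lra.
apply: le_trans sS; rewrite /sigma lerB// /w /u.
have L0 : 0 < (m - M)%:R :> R by rewrite ltr0n subn_gt0.
have L4 : m%:R <= 4 * (m - M)%:R :> R by rewrite -natrM ler_nat.
rewrite ler_pdivrMr ?mulr_gt0 ?exprn_gt0//.
have m1R : 1 <= m%:R :> R by rewrite ler1n.
have -> : 48 * (m%:R^-1 / eta) * (eta * (m - M)%:R ^+ 2)
    = 48 * (m - M)%:R ^+ 2 / m%:R :> R.
  by field; rewrite !gt_eqF.
rewrite ler_pdivlMr//.
have : m%:R ^+ 2 <= (4 * (m - M)%:R) ^+ 2 :> R.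
  by rewrite ler_sqr ?nnegrE ?mulr_ge0 ?ler0n.
move: m1R; move: (m%:R) (m - M)%:R => x l x1; rewrite exprMn => xl.
by nra.
Unshelve. all: by end_near. Qed.

End LowerConst.

Lemma limn_einf_ge (R : realType) (u : (\bar R)^nat) (c : \bar R) :
  (\forall m \near \oo, (c <= u m)%E) -> (c <= limn_einf u)%E.
Proof.
move=> [N _ cu]; rewrite limn_einf_lim; apply: lime_ge; first exact: is_cvg_einfs.
exists N => // m Nm; apply: le_ereal_inf_tmp => _ [p /= mp <-].
exact/cu/(leq_trans Nm).
Qed.

Lemma powR2_4_11_ge (R : realType) : 128 / 100 <= 2 `^ (4 / 11) :> R.
Proof.
rewrite -(@ler_pXn2r _ 11) ?nnegrE ?powR_ge0//.
rewrite -[leRHS]powR_mulrn ?powR_ge0// -powRrM divfK ?pnatr_eq0// powR_mulrn//.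
by lra.
Qed.

(** For M = floor(3m/4) the exponent M/(2(m+1)) tends to 3/8; the smaller 4/11 absorbs the rounding
    and still gives 2^(4/11) >= 1.28. *)
Lemma limn_einf_BH_const_gt (R : realType) :
  ((127%:R / 100%:R)%:E < limn_einf (BH_const R))%E.
Proof.
have [c cE c2] : exists2 c : R, c = 128 / 100 & c <= 2 `^ (4 / 11).
  by exists (128 / 100); [reflexivity|exact: powR2_4_11_ge].
have [kappa [k0 k1 kc]] :
    exists kappa : R, [/\ 0 < kappa, kappa < 1 & 127 / 100 < kappa * c].
  by exists (995 / 1000); rewrite cE; split; lra.
apply: (@lt_le_trans _ _ (kappa * c)%:E); first by rewrite lte_fin.
apply: limn_einf_ge; near=> m.
(* Since 4M >= 3m - 3, the required 11M >= 8(m + 1) follows from m >= 65. *)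
have m65 : (65 <= m)%N by near: m; exact: nbhs_infty_ge.
have Dm : forall M n, (4 * M <= 3 * m)%N -> (M < n)%N ->
    ((kappa * 2 `^ (M%:R / (2 * m.+1%:R)))%:E <= BH_const_dim R m n)%E.
  by near: m; exact: BH_const_dim_eventually_ge.
pose M := ((3 * m) %/ 4)%N.
have MM : (4 * M <= 3 * m)%N by rewrite mulnC leq_trunc_div.
apply: (@le_trans _ _ (BH_const_dim R m M.+1)); last first.
  by apply: ereal_sup_ubound; exists M.+1.
apply: le_trans (Dm M M.+1 MM (ltnSn M)).
rewrite lee_fin ler_wpM2l ?(ltW k0)//; apply: le_trans c2 _.
apply: ler_powR; first by rewrite ler1n.
rewrite ler_pdivlMr ?mulr_gt0// mulrAC ler_pdivrMr// -!natrM ler_nat.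
by rewrite /M; lia.
Unshelve. all: by end_near. Qed.

(** * Convergence to 1 and the growth of the dimension *)

Section DimensionCriterion.
Variables (R : realType) (n_ : nat -> nat).
Hypothesis n_gt0 : forall m, (0 < m)%N -> (0 < n_ m)%N.

Lemma BH_const_dim_cvg1 : (fun m => (n_ m)%:R : R) =o_\oo (fun m => m%:R : R) ->
  (fun m => BH_const_dim R m (n_ m)) @ \oo --> 1%E.
Proof.
move=> /eqoP no.
have bound (e : R) : 0 < e ->
    \forall m \near \oo, (1 <= BH_const_dim R m (n_ m) <= (1 + e)%:E)%E.
  move=> e0; pose y := (1 + e)^-1.
  have e1 : 0 < 1 + e by rewrite addr_gt0.
  have y0 : 0 < y by rewrite invr_gt0.
  have y1 : y < 1 by rewrite invf_lt1// ltrDl.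
  (* Once (K + 1) n_m <= m, this yields y^m <= (y^(K+1))^(n_m) <= (1 - y)^(n_m), as the upper bound
     requires. *)
  have [K yK] : exists K, y ^+ K.+1 <= 1 - y.
    have := @cvg_expr R y; rewrite ger0_norm ?ltW// => /(_ y1)/cvgrPdist_le.
    move=> /(_ (1 - y)); rewrite subr_gt0 => /(_ y1)[K _ /(_ K.+1 (leqnSn K))] /=.
    by rewrite sub0r normrN ger0_norm ?exprn_ge0 ?(ltW y0)// => ?; exists K.
  near=> m; have m0 : (0 < m)%N by near: m; exact: nbhs_infty_gt.
  rewrite BH_const_dim_ge1 ?n_gt0//=.
  rewrite -[1 + e]invrK; apply: BH_const_dim_le => //.
  have nK : (K.+1 * n_ m <= m)%N.
    have : `|(n_ m)%:R : R| <= K.+1%:R^-1 * `|m%:R : R|.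
      by near: m; apply: no; rewrite invr_gt0.
    by rewrite !ger0_norm ?ler0n// ler_pdivlMl// -natrM ler_nat.
  apply: (@le_trans _ _ ((y ^+ K.+1) ^+ n_ m)).
    by rewrite -exprM ler_wiXn2l// ltW.
  by rewrite lerXn2r ?nnegrE ?exprn_ge0 ?subr_ge0 ?(ltW y0) ?(ltW y1).
apply/fine_cvgP; split.
  near=> m; have : (1 <= BH_const_dim R m (n_ m) <= (1 + 1)%:E)%E.
    by near: m; apply: bound.
  by case: BH_const_dim => [r| |] /andP[].
apply/cvgrPdist_le => e e0; near=> m.
have : (1 <= BH_const_dim R m (n_ m) <= (1 + e)%:E)%E by near: m; apply: bound.
rewrite /=; case: BH_const_dim => [r| |] /andP[] //=; rewrite !lee_fin => r1 r2.
by rewrite ler_distlC; lra.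
Unshelve. all: by end_near. Qed.

Lemma littleo_of_BH_const_dim_cvg1 :
  (fun m => BH_const_dim R m (n_ m)) @ \oo --> 1%E ->
  (fun m => (n_ m)%:R : R) =o_\oo (fun m => m%:R : R).
Proof.
move=> /fine_cvgP[Dfin /cvgr_lt D1]; apply/eqoP => e e0.
(* For M = floor(c m), [c < e] ensures M < n_m when n_m > e m, and [c <= 2^-1] ensures 4M <= 3m. *)
pose c := Num.min (e / 2) 2^-1.
have [c0 ce ch] : [/\ 0 < c, c < e & c <= 2^-1].
  by rewrite /c; split; [rewrite lt_min|rewrite gt_min|rewrite ge_min lexx orbT]; lra.
(* One factor [h] pays for kappa = 1/h and another bounds the constant, so M/(2(m+1)) >= c/8 is
   needed; it holds because c m >= 2 gives M >= c m - 1 >= c m / 2, and m + 1 <= 2m. *)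
clearbody c; pose h : R := 2 `^ (c / 16).
have h1 : 1 < h.
  by rewrite /h /powR pnatr_eq0 expR_gt1 mulr_gt0 ?divr_gt0 ?ln_gt0 ?ltr1n.
near=> m; rewrite !ger0_norm ?ler0n// leNgt; apply/negP => en.
have m0 : (0 < m)%N by near: m; exact: nbhs_infty_gt.
have mc : 2 / c <= m%:R :> R by near: m; exact: nbhs_infty_ger.
pose M := Num.truncn (c * m%:R).
have /andP[Mle Mgt] : M%:R <= c * m%:R < M.+1%:R.
  by apply: truncn_itv; rewrite mulr_ge0 ?ler0n ?(ltW c0).
have Mn : (M < n_ m)%N.
  rewrite -(ltr_nat R); apply: le_lt_trans Mle _; apply: lt_trans en.
  by rewrite ltr_pM2r ?ltr0n.
have Mm : (4 * M <= 3 * m)%N.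
  by rewrite -(ler_nat R) !natrM; have := ler0n R m; nra.
have Dm : forall M n, (4 * M <= 3 * m)%N -> (M < n)%N ->
    ((h^-1 * 2 `^ (M%:R / (2 * m.+1%:R)))%:E <= BH_const_dim R m n)%E.
  near: m; apply: BH_const_dim_eventually_ge; first by rewrite invr_gt0 (lt_trans _ h1).
  by rewrite invf_lt1// (lt_trans _ h1).
have := Dm M (n_ m) Mm Mn.
have : fine (BH_const_dim R m (n_ m)) < h by near: m; apply: D1.
have : BH_const_dim R m (n_ m) \is a fin_num by near: m.
case: BH_const_dim => [r| |] //= _ rh; rewrite lee_fin leNgt => /negP; apply.
apply: lt_le_trans rh _; rewrite ler_pdivlMl ?(lt_trans _ h1)//.
rewrite /h -powRD; last by rewrite pnatr_eq0 implybT.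
apply: ler_powR; first by rewrite ler1n.
rewrite ler_pdivlMr ?mulr_gt0//.
have m1 : 1 <= m%:R :> R by rewrite ler1n.
move: mc; rewrite ler_pdivrMr// => mc.
have cm : c <= c * m%:R by rewrite ler_peMr ?(ltW c0).
by move: Mgt; rewrite -[M.+1%:R]natr1 -[m.+1%:R]natr1; lra.
Unshelve. all: by end_near. Qed.

End DimensionCriterion.

Theorem theorem1p3 (R : realType) :
  (forall n_ : nat -> nat, (forall m, (0 < m)%N -> (0 < n_ m)%N) ->
     ((fun m => BH_const_dim R m (n_ m)) @ \oo --> 1%E
      <-> (fun m => (n_ m)%:R : R) =o_\oo (fun m => m%:R : R)))
  /\ ((127%:R / 100%:R)%:E < limn_einf (BH_const R))%E.
Proof.
split; last exact: limn_einf_BH_const_gt.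
move=> n_ n_gt0; split; first exact: littleo_of_BH_const_dim_cvg1.
exact: BH_const_dim_cvg1.
Qed.
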